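(* Let $G$ be a group of homeomorphisms of a Hausdorff space $X$, let $n\ge1$, and let $H_1,\ldots,H_n\le\mathrm{Homeo}(X)$ be subgroups such that $(H_1,\ldots,H_n)$ is confined by $G$. Then there exist $k\le n$ and a non-empty open subset $U\subset X$ such that $H_k$ contains $\mathrm{Rist}_G(U)'$. (In particular, for $n=1$: if $H$ is a confined subgroup of $G$, then $H\supseteq\mathrm{Rist}_G(U)'$ for some non-empty open $U\subset X$.)
   Context: The $n$-tuple $(H_1,\ldots,H_n)$ of subgroups of $\mathrm{Homeo}(X)$ is confined by $G\le\mathrm{Homeo}(X)$ if there exists a finite set $P$ of non-trivial elements of $\mathrm{Homeo}(X)$ such that for every $g\in G$ there exists $j$ with $gH_jg^{-1}\cap P\neq\varnothing$. For $U\subset X$, the rigid stabilizer $\mathrm{Rist}_G(U)$ is the subgroup of elements of $G$ fixing $X\setminus U$ pointwise, and $K'$ denotes the derived (commutator) subgroup of a group $K$. *)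

(* Defs.v *)
From mathcomp Require Import all_boot all_order.
From mathcomp Require Import all_classical all_reals all_analysis.
Set Implicit Arguments. Unset Strict Implicit. Unset Printing Implicit Defensive.
Local Open Scope classical_set_scope.

Section HomeoDefs.
Variable X : topologicalType.

Definition is_inv (f g : X -> X) : Prop := cancel f g /\ cancel g f.

Definition is_homeo (f : X -> X) : Prop :=
  continuous f /\ exists g, is_inv f g /\ continuous g.

Definition homeo_subgroup (H : set (X -> X)) : Prop :=
  [/\ H `<=` is_homeo, H id,
      (forall f g, H f -> H g -> H (f \o g)) &
      (forall f g, H f -> is_inv f g -> H g)].

Definition commutators (K : set (X -> X)) : set (X -> X) :=
  [set c | exists a b ai bi, [/\ K a, K b, is_inv a ai, is_inv b bi &
                                 c = ai \o bi \o a \o b]].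

Definition derived (K : set (X -> X)) : set (X -> X) :=
  [set f | forall S, homeo_subgroup S -> commutators K `<=` S -> S f].

Definition Rist (G : set (X -> X)) (U : set X) : set (X -> X) :=
  [set g | G g /\ forall x, ~ U x -> g x = x].

Definition confined_tuple (G : set (X -> X)) (n : nat)
    (H : 'I_n -> set (X -> X)) : Prop :=
  exists P : seq (X -> X),
    (forall p, p \in P -> is_homeo p /\ p <> id) /\
    forall g, G g -> forall gi, is_inv g gi ->
      exists j : 'I_n, exists h, H j h /\ (g \o h \o gi) \in P.

End HomeoDefs.

(* Main.v *)
Require Import Defs.
From HB Require Import structures.
From mathcomp Require Import all_boot all_order.
From mathcomp Require Import all_classical all_reals all_analysis.
Local Open Scope classical_set_scope.

(** If some rigid stabilizer of a non-empty open set is trivial, there is nothing to prove;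
    otherwise [X] has no isolated point.  Choose open sets [U i], indexed by the elements [p i] of the confining set, pairwise
    disjoint, with [p i] displacing [U i], and such that every [p i] either fixes [U k]
    pointwise or carries it off all the [U l].  Let [K] be the group of elements of [G]
    preserving each [U i] and supported in their union [D], and let [O i] be the union of
    the [U k] not fixed by [p i].  Say that [g] in [K] is an [(i, j)]-conjugator when
    [g^-1 * p i * g] lies in [H j]; confinement says that every element of [K] is one.
    - If [x] and [y] are [(i, j)]-conjugators, some element of [H j] acts on [O i] as
      [x^-1 * y]; the elements of [K] so realized form a subgroup [R].
    - If [g * a], [g * b], [k * a], [k * b] are [(i, j)]-conjugators, a quotient of two such
      elements of [H j] is supported in [O i], and it is trivial on [U i] only if
      [g^-1 * k] commutes with [a * b^-1] on [U i].
    Fix enough elements [a s] of [K] such that all [a s * (a t)^-1], [s <> t], are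
    nontrivial on every [U i].  By the pigeonhole principle [K] is covered by the finitely
    many sets of those [g] for which [g * a s] and [g * a t] are [(i, j)]-conjugators.
    Centralizers on [U i] have infinite index, so B.H. Neumann's lemma on coverings by
    cosets produces [i], [j] with [R] of finite index in [K], together with [f] in [H j]
    supported in [O i] and displacing some open [W] inside [U i].  Then [H j] contains
    [[h, [f, l]]] for all [h], [l] realizing elements of [R] supported in [W], and such a
    commutator does not depend on [f].  To remove the finite index, take disjoint open
    sets in [W] whose rigid stabilizers meet the same cosets of [R], and correct two
    elements of the first one by elements of the second and of the third. *)

Set Implicit Arguments. Unset Strict Implicit. Unset Printing Implicit Defensive.
Local Open Scope group_scope.

(** * Neumann's lemma *)

Definition is_subgroup (gT : groupType) (K : set gT) : Prop :=
  [/\ K 1, forall x y, K x -> K y -> K (x * y) & forall x, K x -> K x^-1].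

Definition finite_index (gT : groupType) (K L : set gT) : Prop :=
  exists F : seq gT, forall x, K x -> exists2 c, c \in F & L (c^-1 * x).

Section Neumann.
Variables (gT : groupType) (K : set gT).
Hypothesis subK : is_subgroup K.

Lemma neumann_cosets (I : eqType) (L : I -> set gT) (s : seq I) (F : I -> seq gT) :
  (forall i, is_subgroup (L i)) -> (forall i, L i `<=` K) ->
  (forall x, K x -> exists i c, [/\ i \in s, c \in F i & L i (c^-1 * x)]) ->
  exists2 i, i \in s & finite_index K (L i).
Proof.
case: subK => K1 KM KV subL LK; elim: s F => [|i s IH] F cov.
  by case: (cov 1 K1) => i [c []].
have [fi|nfi] := pselect (finite_index K (L i)).
  by exists i => //; rewrite mem_head.
have [z Kz zF] : exists2 z, K z & forall c, c \in F i -> ~ L i (c^-1 * z).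
  apply: contrapT => nz; apply: nfi; exists (F i) => x Kx.
  apply: contrapT => nx; apply: nz; exists x => // c cF Lc.
  by apply: nx; exists c.
case: (IH (fun j => F j ++ [seq c * z^-1 * d | c <- F i, d <- F j])) => [x Kx|j js fj]; last first.
  by exists j => //; rewrite in_cons js orbT.
case: (cov x Kx) => j [c [js cF Lcx]].
move: js; rewrite in_cons => /predU1P[ji|js]; last first.
  by exists j, c; split => //; rewrite mem_cat cF.
subst j; have [L1 LM LV] := subL i.
have Ky : K (z * (c^-1 * x)) by apply: KM => //; exact: LK Lcx.
case: (cov _ Ky) => k [d [ks dF Ldy]].
move: ks; rewrite in_cons => /predU1P[ki|ks].
  subst k; case: (zF d dF).
  by rewrite -[d^-1 * z](mulgK (c^-1 * x)); apply: LM; [rewrite -mulgA|exact: LV].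
exists k, (c * z^-1 * d); split => //.
  by rewrite mem_cat; apply/orP; right; apply/allpairsP; exists (c, d).
by rewrite !invgM invgK -!mulgA.
Qed.

(** Each [S i] lies in one left coset of [L i]. Only indices with [S i] nonempty are kept, so the
    index found comes with a witness. *)
Lemma neumann_cover (I : finType) (S L : I -> set gT) :
  (forall i, is_subgroup (L i)) -> (forall i, L i `<=` K) ->
  (forall i x y, S i x -> S i y -> L i (x^-1 * y)) ->
  (forall x, K x -> exists i, S i x) ->
  exists2 i, S i !=set0 & finite_index K (L i).
Proof.
move=> subL LK SL cov.
have ex i : exists c, S i !=set0 -> S i c.
  by have [[c Sc]|nS] := pselect (S i !=set0); [exists c|exists 1].
have [c Sc] := choice ex.
have [|i] := @neumann_cosets I L [seq i <- enum I | `[< S i !=set0 >]]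
  (fun i => [:: c i]) subL LK.
  move=> x /cov[i Six]; exists i, (c i); split; rewrite ?mem_head//.
    by rewrite mem_filter mem_enum andbT; apply/asboolP; exists x.
  by apply: SL => //; apply: Sc; exists x.
by rewrite mem_filter => /andP[/asboolP] *; exists i.
Qed.

Lemma finite_index_conj (L : set gT) (a : gT) :
  K a -> finite_index K [set x | L (a^-1 * x * a)] -> finite_index K L.
Proof.
case: subK => K1 KM KV Ka [F cov]; exists [seq a^-1 * c * a | c <- F] => x Kx.
have /cov[c cF /= Lc] : K (a * x * a^-1) by apply: (KM); [exact: KM|exact: KV].
exists (a^-1 * c * a); first by apply/mapP; exists c.
by move: Lc; rewrite !invgM invgK !mulgA mulgVK.
Qed.

End Neumann.

(** * The group of bijections *)

(** The inverse is stored, so that group inversion swaps two fields; by [bij_ext], equality still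
    depends on the function alone. *)
Record bijT (T : Type) := Bij {
  bij_fun :> T -> T;
  bij_inv : T -> T;
  bij_funK : cancel bij_fun bij_inv;
  bij_invK : cancel bij_inv bij_fun }.

Section BijGroup.
Variable T : Type.
Implicit Types g h : bijT T.

Lemma bij_ext g h : g =1 h -> g = h.
Proof.
case: g h => [g g' gK g'K] [h h' hK h'K] /= /funext gh; subst h.
have g'h' : g' = h' by apply: funext => x; rewrite -{1}(h'K x) gK.
by subst h'; congr Bij; exact: Prop_irrelevance.
Qed.

Definition bij1 : bijT T := @Bij T id id (fun=> erefl) (fun=> erefl).
Definition bijV g : bijT T := Bij (bij_invK g) (bij_funK g).
Definition bijM g h : bijT T :=
  @Bij T (g \o h) (bij_inv h \o bij_inv g)
    (can_comp (bij_funK g) (bij_funK h)) (can_comp (bij_invK h) (bij_invK g)).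

HB.instance Definition _ := gen_eqMixin (bijT T).
HB.instance Definition _ := gen_choiceMixin (bijT T).

Fact bijMA : associative bijM. Proof. by move=> f g h; exact: bij_ext. Qed.
Fact bij1M : left_id bij1 bijM. Proof. by move=> f; exact: bij_ext. Qed.
Fact bijM1 : right_id bij1 bijM. Proof. by move=> f; exact: bij_ext. Qed.
Fact bijVM : left_inverse bij1 bijV bijM.
Proof. by move=> f; apply: bij_ext => x /=; rewrite bij_funK. Qed.
Fact bijMV : right_inverse bij1 bijV bijM.
Proof. by move=> f; apply: bij_ext => x /=; rewrite bij_invK. Qed.

HB.instance Definition _ := isGroup.Build (bijT T) bijMA bij1M bijM1 bijVM bijMV.

Lemma bijEM g h x : (g * h) x = g (h x). Proof. by []. Qed.
Lemma bijK g : cancel g g^-1%g. Proof. exact: bij_funK. Qed.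
Lemma bijKV g : cancel g^-1%g g. Proof. exact: bij_invK. Qed.

Lemma bij_neq1 g : g <> 1 -> exists x, g x <> x.
Proof.
move=> g1; apply: contrapT => nx; apply: g1; apply: bij_ext => x.
by apply: contrapT => gx; apply: nx; exists x.
Qed.

Definition supported_in g (U : set T) : Prop := forall x, ~ U x -> g x = x.

Lemma supported_inV g U : supported_in g U -> supported_in g^-1 U.
Proof. by move=> gU x /gU {1}<-; rewrite bijK. Qed.

Lemma supported_inM g h U :
  supported_in g U -> supported_in h U -> supported_in (g * h) U.
Proof. by move=> gU hU x nU; rewrite bijEM hU// gU. Qed.

Lemma supported_inW g (U V : set T) : U `<=` V -> supported_in g U -> supported_in g V.
Proof. by move=> UV gU x nV; apply: gU => /UV. Qed.

Lemma supported_in_stable g U x : supported_in g U -> U (g x) <-> U x.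
Proof.
move=> gU; split => Ux; apply: contrapT => nU; first by apply: (nU); rewrite -(gU x nU).
by have := supported_inV gU nU; rewrite bijK => xg; apply: (nU); rewrite -xg.
Qed.

Lemma supported_in_commute g h U V :
  supported_in g U -> supported_in h V -> (forall x, U x -> ~ V x) -> commute g h.
Proof.
move=> gU hV UV; apply: bij_ext => x; rewrite !bijEM.
have [Vx|nVx] := pselect (V x); last first.
  rewrite (hV x nVx); have [Ux|nUx] := pselect (U x); last by rewrite gU// hV.
  by rewrite hV// => Vg; apply: (UV (g x)) => //; apply/supported_in_stable.
rewrite (gU x) => [|/UV//]; rewrite gU// => /UV; apply.
exact/supported_in_stable.
Qed.

End BijGroup.

(** * Conjugates of a single map *)

Lemma commutator_mul_commute (gT : groupType) (u v w : gT) :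
  commute u w -> commute v w ->
  u * v^-1 * u^-1 * v = u * (w * v^-1) * u^-1 * (w * v^-1)^-1.
Proof.
move=> /commute_sym wu /commute_sym wv; rewrite invgM invgK !mulgA -wu.
have : commute w (u * v^-1 * u^-1 * v).
  by apply: commuteM => //; apply: commuteM; [apply: commuteM => //|]; exact: commuteV.
by rewrite /commute !mulgA => ->; rewrite mulgK.
Qed.

Section LocalAction.
Variables (T : Type) (D O : set T) (K H : set (bijT T)) (p : bijT T).
Hypotheses (subK : is_subgroup K) (subH : is_subgroup H).

Definition stabilizes (g : bijT T) : Prop := forall x, O (g x) <-> O x.
Definition agree (h g : bijT T) : Prop := forall x, O x -> h x = g x.
Definition realized : set (bijT T) := [set g | K g /\ exists2 h, H h & agree h g].
Definition conjugators : set (bijT T) := [set g | K g /\ H (g^-1 * p * g)].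

Hypotheses (KO : forall g, K g -> stabilizes g)
  (KD : forall g, K g -> supported_in g D).

Lemma stabilizesV g : stabilizes g -> stabilizes g^-1.
Proof. by move=> gO x; rewrite -{2}(bijKV g x) gO. Qed.

Lemma agreeM h h' g g' :
  agree h g -> agree h' g' -> stabilizes g' -> agree (h * h') (g * g').
Proof. by move=> hg hg' g'O x Ox; rewrite !bijEM hg' ?hg// g'O. Qed.

Lemma agreeV h g : agree h g -> stabilizes g -> agree h^-1 g^-1.
Proof.
move=> hg /stabilizesV gO x Ox; apply: (can_inj (bijK h)).
by rewrite bijKV hg ?bijKV// gO.
Qed.

Lemma realized_subgroup : is_subgroup realized.
Proof.
have [K1 KM KV] := subK; have [H1 HM HV] := subH; split.
- by split => //; exists 1.
- move=> g g' [Kg [h Hh hg]] [Kg' [h' Hh' hg']]; split; first exact: KM.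
  by exists (h * h'); [exact: HM|apply: agreeM => //; exact: KO].
- move=> g [Kg [h Hh hg]]; split; first exact: KV.
  by exists h^-1; [exact: HV|apply: agreeV => //; exact: KO].
Qed.

(** As [f] carries [W] off itself, [k' = f k f^-1] commutes with [g] and [k], so multiplying [k^-1]
    by [k'] leaves the commutator unchanged. On [O], [k' k^-1] agrees with [[f, l]], which lies in
    [H]. *)
Lemma commutator_mem (f : bijT T) (W : set T) (g k : bijT T) :
  H f -> supported_in f O -> W `<=` O -> (forall x, W x -> ~ W (f x)) ->
  realized g -> realized k -> supported_in g W -> supported_in k W ->
  H (g * k^-1 * g^-1 * k).
Proof.
move=> Hf fO WO fW [Kg [h Hh hg]] [Kk [l Hl lk]] gW kW.
have [H1 HM HV] := subH.
have fst : stabilizes f by move=> x; exact: supported_in_stable.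
have gst := KO Kg; have kst := KO Kk.
have fVst := stabilizesV fst; have gVst := stabilizesV gst.
have kVst := stabilizesV kst.
have MO a b : stabilizes a -> stabilizes b -> stabilizes (a * b).
  by move=> aO bO x; rewrite bijEM aO bO.
set k' := f * k * f^-1.
have ck' a : supported_in a W -> commute a k'.
  move=> aW; apply: (@supported_in_commute _ _ _ W (f @` W)) => //; last first.
    by move=> x Wx [y Wy fy]; apply: (fW y) => //; rewrite fy.
  move=> x nW; rewrite !bijEM kW ?bijKV// => Wx; apply: nW.
  by exists (f^-1 x) => //; rewrite bijKV.
have -> : g * k^-1 * g^-1 * k =
    h * (f * l * f^-1 * l^-1) * h^-1 * (f * l * f^-1 * l^-1)^-1; last first.
  have Hc : H (f * l * f^-1 * l^-1).
    by apply: (HM); [apply: (HM); [exact: HM|exact: HV]|exact: HV].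
  by apply: (HM); [apply: (HM); [exact: HM|exact: HV]|exact: HV].
have -> : g * k^-1 * g^-1 * k = g * (k' * k^-1) * g^-1 * (k' * k^-1)^-1.
  by apply: commutator_mul_commute; exact: ck'.
have kk : agree (f * l * f^-1 * l^-1) (k' * k^-1).
  apply: agreeM => //; last exact: agreeV.
  by apply: agreeM => //; exact: agreeM.
have ck'O : stabilizes (k' * k^-1) by apply: (MO) => //; apply: (MO) => //; exact: MO.
have lst z : ~ O z -> ~ O (l^-1 z).
  by move=> nO Ol; apply: (nO); rewrite -(bijKV l z) lk// kst.
have hst z : ~ O z -> ~ O (h^-1 z).
  by move=> nO Ol; apply: (nO); rewrite -(bijKV h z) hg// gst.
(* Off [O], [f] is trivial and [l] preserves the complement, so [[f, l]] is trivial there even if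
   [l] is not. *)
have cl : supported_in (f * l * f^-1 * l^-1) O.
  move=> z nO; rewrite !bijEM.
  by rewrite (supported_inV fO) ?bijKV ?fO//; exact: lst.
apply: bij_ext => z; have [Oz|nOz] := pselect (O z).
  symmetry; apply: (@agreeM) Oz => //; last exact: stabilizesV.
    apply: agreeM => //; last exact: agreeV.
    exact: agreeM.
  exact: agreeV.
have sup (a b : bijT T) : supported_in a O -> supported_in b O -> supported_in (a * b) O.
  exact: supported_inM.
have gO : supported_in g O by exact: supported_inW gW.
have kO : supported_in k O by exact: supported_inW kW.
have k'O : supported_in k' O.
  by apply: (sup); [exact: sup|exact: supported_inV].
have k'kO : supported_in (k' * k^-1) O.
  by apply: (sup) => //; exact: supported_inV.
rewrite [LHS](_ : _ = z); last first.
  apply: (sup) => //; last exact: supported_inV.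
  by apply: (sup); [exact: sup|exact: supported_inV].
rewrite bijEM (supported_inV cl)// bijEM [in RHS]bijEM.
by rewrite cl ?bijKV//; exact: hst.
Qed.

Hypotheses (pVO : forall x, O x -> ~ D (p^-1 x))
  (pD : forall x, D x -> ~ O x -> p x = x).

Lemma conjugators_quotient_mem x y : conjugators x -> conjugators y ->
  H (x^-1 * p * (x * y^-1) * p^-1 * y).
Proof.
have [H1 HM HV] := subH; move=> [Kx Hx] [Ky Hy].
have := HM _ _ Hx (HV _ Hy).
by rewrite !invgM invgK !mulgA.
Qed.

(** [p^-1] throws [O] off [D], where [x * y^-1] is the identity, so [p] and [p^-1] cancel. *)
Lemma conjugators_quotient_agree x y : conjugators x -> conjugators y ->
  agree (x^-1 * p * (x * y^-1) * p^-1 * y) (x^-1 * y).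
Proof.
move=> [Kx Hx] [Ky Hy] z Oz; rewrite !bijEM.
have nD : ~ D (p^-1 (y z)) by apply: pVO; rewrite KO.
by rewrite (supported_inV (KD Ky))// (KD Kx)// bijKV.
Qed.

(** Off [O] the quotient depends on [x] and [y] only through [x * y^-1], so quotients sharing this
    product agree there. *)
Lemma conjugators_quotient_out x y z : K x -> K y -> ~ O z ->
  (D z /\ (x^-1 * p * (x * y^-1) * p^-1 * y) z = z) \/
  (~ D z /\ (x^-1 * p * (x * y^-1) * p^-1 * y) z = p ((x * y^-1) (p^-1 z))).
Proof.
have [_ KM KV] := subK; move=> Kx Ky nOz.
have pVD w : D w -> ~ O w -> p^-1 w = w.
  by move=> Dw nOw; rewrite -{1}(pD Dw nOw) bijK.
have KDE g w : K g -> D (g w) <-> D w.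
  by move=> /KD gD; exact: supported_in_stable.
have [Dz|nDz] := pselect (D z); [left|right]; split => //.
  have xO : D (x z) /\ ~ O (x z) by rewrite KDE// KO.
  have yO : D (y z) /\ ~ O (y z) by rewrite KDE// KO.
  rewrite !bijEM pVD; [|tauto|tauto]; rewrite bijK pD; [|tauto|tauto].
  by rewrite bijK.
have Kt : K (x * y^-1) by apply: (KM) => //; exact: KV.
rewrite !(bijEM, KD Ky nDz) -(bijEM x); set t := x * y^-1.
apply: (supported_inV (KD Kx)) => Dv.
have [Ov|nOv] := pselect (O (p (t (p^-1 z)))).
  have := pVO Ov; rewrite bijK KDE// => nD; apply: nDz.
  by move: Dv; rewrite (KD Kt nD) bijKV.
have tv : t (p^-1 z) = p (t (p^-1 z)) by rewrite -[LHS](bijK p) pVD.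
have Dw : D (p^-1 z) by rewrite -(KDE t)// tv.
have nOw : ~ O (p^-1 z) by rewrite -(KO Kt) tv.
by apply: nDz; rewrite -(bijKV p z) pD.
Qed.

Lemma conjugators_realized x y : conjugators x -> conjugators y -> realized (x^-1 * y).
Proof.
have [K1 KM KV] := subK; move=> cx cy; split.
  by case: cx cy => Kx _ [Ky _]; apply: KM => //; exact: KV.
eexists; first exact: conjugators_quotient_mem cx cy.
exact: conjugators_quotient_agree.
Qed.

(** The quotients [q1] of [g a, k a] and [q2] of [g b, k b] share the product [g k^-1], hence agree
    off [O]; take [f = q1 q2^-1]. *)
Lemma four_conjugators (a b g k : bijT T) : K a -> K b ->
  conjugators (g * a) -> conjugators (g * b) ->
  conjugators (k * a) -> conjugators (k * b) ->
  exists f, [/\ H f, supported_in f O &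
    agree f (a^-1 * (g^-1 * k) * a * (b^-1 * (g^-1 * k)^-1 * b))].
Proof.
have [K1 KM KV] := subK; have [H1 HM HV] := subH.
move=> Ka Kb cga cgb cka ckb.
have Kgk : K (g * k^-1).
  have := KM _ _ cga.1 (KV _ cka.1).
  by rewrite invgM !mulgA mulgK.
have e x : (g * x) * (k * x)^-1 = g * k^-1 by rewrite invgM !mulgA mulgK.
have mem1 := conjugators_quotient_mem cga cka.
have mem2 := conjugators_quotient_mem cgb ckb.
have ag1 := conjugators_quotient_agree cga cka.
have ag2 := conjugators_quotient_agree cgb ckb.
rewrite !e in mem1 mem2 ag1 ag2.
set q1 := _ * (k * a) in mem1 ag1.
set q2 := _ * (k * b) in mem2 ag2.
exists (q1 * q2^-1); split.
- by apply: HM => //; exact: HV.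
- move=> z nOz; rewrite bijEM.
  have nOw : ~ O (q2^-1 z).
    move=> Ow; apply: nOz; rewrite -(bijKV q2 z) ag2//.
    rewrite KO//; apply: (KM); [apply: (KV); exact: cgb.1|exact: ckb.1].
  have qE := conjugators_quotient_out.
  have := qE _ _ _ cga.1 cka.1 nOw; have := qE _ _ _ cgb.1 ckb.1 nOw.
  rewrite !e -/q1 -/q2 bijKV.
  by move=> [[D1 e1]|[D1 e1]] [[D2 ->]|[D2 ->]] //; rewrite -?e1.
- have st : stabilizes ((g * b)^-1 * (k * b)).
    by apply: KO; apply: (KM); [apply: (KV); exact: cgb.1|exact: ckb.1].
  have := agreeM ag1 (agreeV ag2 st) (stabilizesV st).
  by rewrite !invgM !invgK !mulgA.
Qed.
End LocalAction.

(** * Generic families of open sets *)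

Section Shrinking.
Variable X : topologicalType.
Hypothesis hX : hausdorff_space X.

Definition open_nonempty (U : set X) : Prop := open U /\ U !=set0.

Lemma hausdorff_separation (x y : X) : x <> y -> exists A B : set X,
  [/\ open A, open B, A x, B y & forall z, A z -> ~ B z].
Proof.
move=> /eqP xy; have := hX; rewrite open_hausdorff => /(_ _ _ xy)[[A B]] /=.
rewrite !inE => -[Ax By] [oA oB AB]; exists A, B; split => // z Az Bz.
by have : (A `&` B) z by []; rewrite AB.
Qed.

Lemma displaced_nbhs (f : X -> X) (U : set X) (x : X) :
  continuous f -> open U -> U x -> f x <> x ->
  exists W, [/\ open_nonempty W, W `<=` U & forall y, W y -> ~ W (f y)].
Proof.
move=> cf oU Ux /hausdorff_separation[A [B [oA oB Afx Bx AB]]].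
exists (U `&` B `&` f @^-1` A); split.
- split; last by exists x.
  by apply: openI; [exact: openI|move/continuousP : cf; exact].
- by move=> y [[]].
- by move=> y [_ Ay] [[_ By] _]; exact: (AB (f y)).
Qed.

(** Finite genericity: each constraint can be met by shrinking and survives further shrinking, so
    they are imposed one by one. *)
Lemma shrink_all (I : Type) (C : eqType) (s : seq C) (Q : C -> (I -> set X) -> Prop)
    (U : I -> set X) :
  (forall c U V, (forall i, V i `<=` U i) -> Q c U -> Q c V) ->
  (forall c U, (forall i, open_nonempty (U i)) -> exists V,
     [/\ forall i, open_nonempty (V i), forall i, V i `<=` U i & Q c V]) ->
  (forall i, open_nonempty (U i)) ->
  exists V, [/\ forall i, open_nonempty (V i), forall i, V i `<=` U i &
                forall c, c \in s -> Q c V].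
Proof.
move=> mono dense oU; elim: s => [|c s [V [oV VU QV]]].
  by exists U; split => // i; exact: subset_refl.
have [W [oW WV QW]] := dense c V oV; exists W; split => //.
  by move=> i; exact: subset_trans (WV i) (VU i).
move=> d; rewrite in_cons => /predU1P[->//|/QV]; exact: mono.
Qed.

Hypothesis two_points : forall U, open_nonempty U -> exists x y, [/\ U x, U y & x <> y].

Lemma generic_family (I C : finType) (p : C -> X -> X) (U : I -> set X) :
  (forall c, continuous (p c)) -> (forall i, open_nonempty (U i)) ->
  exists V, [/\ forall i, open_nonempty (V i), forall i, V i `<=` U i &
    forall c i j x y, V i x -> V j (p c x) -> V i y -> i = j /\ p c y = y].
Proof.
move=> cp oU.
pose Q (c : C * I * I) (V : I -> set X) := let: (c, i, j) := c in
  forall x y, V i x -> V j (p c x) -> V i y -> i = j /\ p c y = y.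
case: (@shrink_all I (C * I * I)%type (enum {: C * I * I}) Q U) => //.
- move=> [[c i] j] V W WV /= QV x y Wx Wp Wy.
  by apply: (QV x); exact: WV.
- move=> [[c i] j] {}U {}oU /=.
  (* Either nothing has to be done, or neighbourhoods of [p c x] and [y] can be separated. If
     [i = j], a single set shrinks around both points, hence the demand [x = y]. *)
  have [fix_|[x [y [Ux Uy pxy exy]]]] : (i = j /\ (forall x, U i x -> p c x = x)) \/
      exists x y, [/\ U i x, U j y, p c x <> y & i = j -> x = y].
    have [ij|ij] := pselect (i = j).
      subst j; have [|nf] := pselect (forall x, U i x -> p c x = x); first by left.
      right; apply: contrapT => nx; apply: nf => x Ux; apply: contrapT => px.
      by apply: nx; exists x, x.
    right; have [x Ux] := (oU i).2; have [y [z [Uy Uz yz]]] := two_points (oU j).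
    have [pxy|pxy] := pselect (p c x = y); last by exists x, y.
    by exists x, z; split => //; rewrite pxy.
  - exists U; split => // [k|x y _ _ Uy]; first exact: subset_refl.
    split; [exact: fix_.1|exact: fix_.2].
  have [A [B [oA oB Ap By AB]]] := hausdorff_separation pxy.
  exists (fun k => U k `&` [set z | k = i -> A (p c z)] `&` [set z | k = j -> B z]).
  split.
  + move=> k; split.
      apply: openI; first apply: openI; first exact: (oU k).1.
      - have [ki|ki] := pselect (k = i).
          rewrite (_ : [set _ | _] = p c @^-1` A); first by move/continuousP : (cp c); exact.
          by apply/seteqP; split => z /=; [apply|].
        rewrite (_ : [set _ | _] = setT); first exact: openT.
        by apply/seteqP; split => z //= _ /ki.
      - have [kj|kj] := pselect (k = j).
          rewrite (_ : [set _ | _] = B)//.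
          by apply/seteqP; split => z /=; [apply|].
        rewrite (_ : [set _ | _] = setT); first exact: openT.
        by apply/seteqP; split => z //= _ /kj.
    have [ki|ki] := pselect (k = i).
      by exists x; split; [split=> //; rewrite ki|move=> /= kj; rewrite exy// -ki].
    have [kj|kj] := pselect (k = j); first by exists y; split; [split=> //; rewrite kj|].
    by have [z Uz] := (oU k).2; exists z; split => [|/kj//]; split => // /ki.
  + by move=> k z [[]].
  + move=> u v [[_ /(_ erefl) Au] _] [_ /= /(_ erefl)]; by move/AB : Au.
- move=> V [oV VU QV]; exists V; split => // c i j.
  by apply: (QV (c, i, j)); rewrite mem_enum.
Qed.

Lemma disjoint_family (I : finType) (U : I -> set X) :
  (forall i, open_nonempty (U i)) ->
  exists V, [/\ forall i, open_nonempty (V i), forall i, V i `<=` U i &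
    forall i j x, V i x -> V j x -> i = j].
Proof.
move=> /(@generic_family I unit (fun=> id) U (fun _ _ _ => id))[V [oV VU gV]].
by exists V; split => // i j x Vi Vj; have [] := gV tt i j x x Vi Vj Vi.
Qed.

End Shrinking.

(** * Pigeonhole principle and gluing of maps with disjoint supports *)

Lemma finite_collision (A B : finType) (f : A -> B) :
  (#|B| < #|A|)%N -> exists a b, a <> b /\ f a = f b.
Proof.
move=> BA; apply: contrapT => nab; move: BA; rewrite ltnNge => /negP; apply.
apply: (@leq_card _ _ f) => a b fab; apply: contrapT => ab.
by apply: nab; exists a, b.
Qed.

Lemma glue_disjoint (T : Type) (I : eqType) (G : set (bijT T)) (U : I -> set T)
    (r : I -> bijT T) (s : seq I) :
  is_subgroup G -> (forall i j x, U i x -> U j x -> i = j) ->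
  (forall i, G (r i)) -> (forall i, supported_in (r i) (U i)) ->
  exists g, [/\ G g, forall i x, i \in s -> U i x -> g x = r i x &
                forall x, (forall i, i \in s -> ~ U i x) -> g x = x].
Proof.
move=> [G1 GM _] dU Gr rU; elim: s => [|i s [g [Gg gr gid]]]; first by exists 1.
(* A repeated index is skipped, as [r i] would otherwise act twice. *)
have [is_|/negP is_] := boolP (i \in s).
  exists g; split => // [j x|x nU].
    by rewrite in_cons => /predU1P[->|]; exact: gr.
  by apply: gid => j js; apply: nU; rewrite in_cons js orbT.
exists (r i * g); split; first exact: GM.
  move=> j x; rewrite in_cons bijEM => /predU1P[->|js] Ux.
    by rewrite gid// => k ks Uk; apply: is_; rewrite (dU i k x).
  rewrite (gr j)// rU// => Ui; apply: is_; rewrite (dU i j (r j x))//.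
  exact/supported_in_stable.
move=> x nU; rewrite bijEM gid => [|j js]; last by apply: nU; rewrite in_cons js orbT.
by apply: rU; apply: nU; rewrite mem_head.
Qed.

(** * Confined tuples *)

Definition rist (T : Type) (G : set (bijT T)) (W : set T) : set (bijT T) :=
  [set g | G g /\ supported_in g W].

Definition block_group (T I : Type) (G : set (bijT T)) (U : I -> set T) : set (bijT T) :=
  [set g | [/\ G g, forall i, stabilizes (U i) g & supported_in g (\bigcup_i U i)]].

(** Whole blocks are taken, not just the moved points, so that [block_group] preserves this set. *)
Definition moved_blocks (T I : Type) (U : I -> set T) (f : T -> T) : set T :=
  [set x | exists i, U i x /\ exists2 y, U i y & f y <> y].

Lemma block_group_subgroup (T I : Type) (G : set (bijT T)) (U : I -> set T) :
  is_subgroup G -> is_subgroup (block_group G U).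
Proof.
move=> [G1 GM GV]; split.
- by split.
- move=> g h [Gg gU gD] [Gh hU hD]; split; [exact: GM| |exact: supported_inM].
  by move=> i x; rewrite bijEM gU hU.
- move=> g [Gg gU gD]; split; [exact: GV| |exact: supported_inV].
  by move=> i; exact: stabilizesV.
Qed.

Lemma rist_block_group (T I : Type) (G : set (bijT T)) (U : I -> set T) (W : set T) i :
  (forall i j x, U i x -> U j x -> i = j) -> W `<=` U i ->
  rist G W `<=` block_group G U.
Proof.
move=> dU WU g [Gg gW]; have gU : supported_in g (U i) by exact: supported_inW gW.
split => // [j x|]; last by apply: supported_inW gU => x Ux; exists i.
have [Ux|nUx] := pselect (U i x); last by rewrite gU.
have Ug : U i (g x) by apply/supported_in_stable.
by split => Uj; [rewrite -(dU i j (g x))|rewrite -(dU i j x)].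
Qed.

(** With the next lemma, this lets [v] be replaced by a corrected [w^-1 * v] lying in a given
    subgroup, without changing the commutator. *)
Lemma commutator_drop_left (gT : groupType) (u v w : gT) :
  commute w v -> commute w u ->
  (w^-1 * v) * u^-1 * (w^-1 * v)^-1 * u = v * u^-1 * v^-1 * u.
Proof.
move=> wv wu; have : commute w (v * u^-1 * v^-1).
  by apply: commuteM; [apply: commuteM => //|]; exact: commuteV.
rewrite invgM invgK /commute !mulgA => e.
have e2 : w^-1 * v * u^-1 * v^-1 * w = v * u^-1 * v^-1.
  by apply: (mulgI w); rewrite !mulgA mulgV mul1g e.
by rewrite e2.
Qed.

Lemma commutator_drop_right (gT : groupType) (u v w : gT) :
  commute w v ->
  v * (w^-1 * u)^-1 * v^-1 * (w^-1 * u) = v * u^-1 * v^-1 * u.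
Proof.
move=> wv; rewrite invgM invgK !mulgA; congr (_ * _).
have wvV : w * v^-1 = v^-1 * w by exact: commuteV.
by rewrite -(mulgA _ w) wvV !mulgA mulgK.
Qed.

(** * Rigid stabilizers and the confinement argument *)

Section Confined.
Variables (X : topologicalType) (G : set (bijT X)) (I J : finType).
Variables (p : I -> bijT X) (H : J -> set (bijT X)).
Hypotheses (hX : hausdorff_space X) (subG : is_subgroup G)
  (subH : forall j, is_subgroup (H j)).
Hypotheses (contG : forall g, G g -> continuous g)
  (contH : forall j g, H j g -> continuous g) (contp : forall i, continuous (p i)).
Hypothesis p_neq1 : forall i, p i <> 1.
Hypothesis confined : forall g, G g -> exists i j, H j (g^-1 * p i * g).
Hypothesis rist_nontrivial :
  forall W : set X, open_nonempty W -> exists2 g, rist G W g & g <> 1.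

Lemma rist_moves (W : set X) : open_nonempty W ->
  exists g x, [/\ rist G W g, W x & g x <> x].
Proof.
move=> /rist_nontrivial[g [Gg gW] /bij_neq1[x gx]]; exists g, x; split => //.
by apply: contrapT => nW; apply: gx; exact: gW.
Qed.

Lemma rist_two_points (W : set X) : open_nonempty W -> exists x y, [/\ W x, W y & x <> y].
Proof.
move=> /rist_moves[g [x [[_ gW] Wx gx]]]; exists x, (g x); split => //.
  exact/supported_in_stable.
exact/nesym.
Qed.

Lemma rist_sub (W W' : set X) : W `<=` W' -> rist G W `<=` rist G W'.
Proof. by move=> WW g [Gg gW]; split => //; exact: supported_inW gW. Qed.

Lemma rist_subgroup (W : set X) : is_subgroup (rist G W).
Proof.
have [G1 GM GV] := subG; split => //.
- by move=> g h [Gg gW] [Gh hW]; split; [exact: GM|exact: supported_inM].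
- by move=> g [Gg gW]; split; [exact: GV|exact: supported_inV].
Qed.

Lemma rist_commute (V W : set X) g h : (forall x, V x -> ~ W x) ->
  rist G V g -> rist G W h -> commute g h.
Proof. by move=> VW [_ gV] [_ hW]; exact: supported_in_commute VW. Qed.

Lemma constant_disjoint_family (n : nat) (W : set X) : open_nonempty W ->
  exists V : 'I_n -> set X, [/\ forall i, open_nonempty (V i), forall i, V i `<=` W &
    forall i j x, V i x -> V j x -> i = j].
Proof.
move=> oW; exact: (disjoint_family hX rist_two_points (fun _ : 'I_n => oW)).
Qed.

(* An open set whose rigid stabilizer meets the least number of cosets of L: every
   smaller open set meets the same cosets. *)
Lemma rist_coset_rigid (L : set (bijT X)) (W : set X) : open_nonempty W ->
  finite_index (rist G W) L ->
  exists W0, [/\ open_nonempty W0, W0 `<=` W &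
    forall V, open_nonempty V -> V `<=` W0 -> forall v, rist G W0 v ->
    exists v' c, [/\ rist G V v', L (c^-1 * v) & L (c^-1 * v')]].
Proof.
move=> oW [F0 F0P].
pose Q q := exists W0 F, [/\ open_nonempty W0, W0 `<=` W, size F = q &
  forall v, rist G W0 v -> exists2 c, c \in F & L (c^-1 * v)].
have exQ : exists q, `[< Q q >].
  exists (size F0); apply/asboolP; exists W, F0; split => //; exact: subset_refl.
case: (ex_minnP exQ) => q /asboolP[W0 [F [oW0 W0W szF FP]]] qmin.
exists W0; split => // V oV VW0 v /FP[c cF Lcv].
have [[v' rv' Lv']|nv'] := pselect (exists2 v', rist G V v' & L (c^-1 * v')).
  by exists v', c.
(* Otherwise [c] could be struck from the list for [V], against the minimality of [q]. *)
have : (q <= size (rem c F))%N.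
  apply: qmin; apply/asboolP; exists V, (rem c F); split => //.
    exact: subset_trans W0W.
  move=> w rw; have [d dF Ld] := FP w (rist_sub VW0 rw); exists d => //.
  have dc : d != c by apply/eqP => dc; apply: nv'; exists w; rewrite -?dc.
  by move: dF; rewrite (perm_mem (perm_to_rem cF)) in_cons (negbTE dc).
rewrite size_rem// szF; case: q szF {qmin} => [/size0nil F0E|q _]; first by rewrite F0E in cF.
by rewrite /= ltnn.
Qed.

(** With more disjoint open sets than cosets, two nontrivial elements supported in different ones
    share a coset; their quotient lies in [L] and in [rist G W], yet moves a point. *)
Lemma rist_infinite_index (K L : set (bijT X)) (W : set X) : open_nonempty W ->
  rist G W `<=` K -> is_subgroup L -> (forall g, L g -> rist G W g -> g = 1) ->
  ~ finite_index K L.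
Proof.
move=> oW rK [_ LM LV] L1 [F FP].
have [V [oV VW dV]] := constant_disjoint_family (size F).+1 oW.
have ex m : exists gk : bijT X * 'I_(size F),
    [/\ rist G (V m) gk.1, gk.1 <> 1 & L ((nth 1 F gk.2)^-1 * gk.1)].
  have [g rg g1] := rist_nontrivial (oV m).
  have [c cF Lc] := FP _ (rK _ (rist_sub (@VW m) rg)).
  have ic : (index c F < size F)%N by rewrite index_mem.
  by exists (g, Ordinal ic) => /=; rewrite nth_index.
have [r rP] := choice ex.
have [|m [k [mk e]]] := @finite_collision 'I_(size F).+1 'I_(size F) (fun m => (r m).2).
  by rewrite !card_ord.
have [rm _ Lm] := rP m; have [rk rk1 Lk] := rP k; rewrite e in Lm.
have [_ RM RV] := rist_subgroup W.
have Lmk : L ((r m).1^-1 * (r k).1).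
  by have := LM _ _ (LV _ Lm) Lk; rewrite invgM invgK !mulgA mulgK.
have Rmk : rist G W ((r m).1^-1 * (r k).1).
  by apply: (RM); [apply: (RV); apply: rist_sub rm|apply: rist_sub rk]; exact: VW.
have [x rx] := bij_neq1 rk1.
have Vx : V k x by apply: contrapT => nV; apply: rx; case: rk => _ /(_ x nV).
have : ((r m).1^-1 * (r k).1) x = x by rewrite (L1 _ Lmk Rmk).
rewrite bijEM (supported_inV rm.2) => // Vm; apply: mk.
by apply: (dV m k ((r k).1 x)) => //; apply/(supported_in_stable _ rk.2).
Qed.

Lemma generic_blocks : exists U : I -> set X,
  [/\ forall i, open_nonempty (U i),
      forall i j x, U i x -> U j x -> i = j,
      forall i x, U i x -> ~ U i (p i x) &
      forall c i j x y, U i x -> U j (p c x) -> U i y -> i = j /\ p c y = y].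
Proof.
have ex i : exists W, open_nonempty W /\ forall x, W x -> ~ W (p i x).
  have [x px] := bij_neq1 (@p_neq1 i).
  have [W [oW _ dW]] := displaced_nbhs hX (@contp i) openT (Logic.I : setT x) px.
  by exists W.
have [W WP] := choice ex.
have [V [oV VW dV]] := disjoint_family hX rist_two_points (fun i => (WP i).1).
have [U [oU UV gU]] := generic_family hX rist_two_points contp oV.
exists U; split => //.
  by move=> i j x /UV Vi /UV Vj; exact: dV Vi Vj.
by move=> i x /UV/VW Wx /UV/VW; exact: (WP i).2.
Qed.

(** * The argument for a fixed generic family of blocks *)

Section Blocks.
Variable U : I -> set X.
Hypotheses (oU : forall i, open_nonempty (U i))
  (dU : forall i j x, U i x -> U j x -> i = j)
  (pU : forall i x, U i x -> ~ U i (p i x))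
  (gU : forall c i j x y, U i x -> U j (p c x) -> U i y -> i = j /\ p c y = y).

Let K := block_group G U.
Let D := \bigcup_i U i.
Let O i := moved_blocks U (p i).

Let subK : is_subgroup K. Proof. exact: block_group_subgroup. Qed.

Let KD g : K g -> supported_in g D. Proof. by case. Qed.

Let KO i g : K g -> stabilizes (O i) g.
Proof.
move=> [_ gUk _] x; split=> -[k [Ux [y Uy py]]]; exists k; split.
- by rewrite -gUk.
- by exists y.
- by rewrite gUk.
- by exists y.
Qed.

(** By genericity, a block with a point sent by [p i] into block [k] is block [k] itself, fixed
    pointwise; [O i] omits such blocks. *)
Let pVO i x : O i x -> ~ D ((p i)^-1 x).
Proof.
move=> [k [Ux [y Uy py]]] [l _ Ul].
have Uk : U k (p i ((p i)^-1 x)) by rewrite bijKV.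
have [lk _] := gU Ul Uk Ul; subst l.
by apply: py; have [] := gU Ul Uk Uy.
Qed.

Let pD i x : D x -> ~ O i x -> p i x = x.
Proof.
move=> [k _ Ux] nO; apply: contrapT => px; apply: nO; exists k; split => //.
by exists x.
Qed.

Let UO i : U i `<=` O i.
Proof.
move=> x Ux; exists i; split => //; exists x => // px.
by apply: (pU Ux); rewrite px.
Qed.

Let conf i j := conjugators K (H j) (p i).
Let real i j := realized (O i) K (H j).

Let real_subgroup i j : is_subgroup (real i j).
Proof. exact: (realized_subgroup subK (subH j) (@KO i)). Qed.

(** Choose disjoint [V (i, t)] inside [U i] and elements moving a point of each; [a t] glues those
    of index [t] over all [i]. The other [a s] are trivial on [V (i, t)], so [a s * (a t)^-1] moves
    a point there. *)
Lemma spread_elements (n : nat) : exists a : 'I_n -> bijT X,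
  (forall s, K (a s)) /\
  forall s t i, s <> t -> exists2 x, U i x & (a s * (a t)^-1) x <> x.
Proof.
have [V [oV VU dV]] :=
  disjoint_family hX rist_two_points (fun it : I * 'I_n => oU it.1).
have exg it : exists gx : bijT X * X,
    [/\ rist G (V it) gx.1, V it gx.2 & gx.1 gx.2 <> gx.2].
  by have [g [x P]] := rist_moves (oV it); exists (g, x).
have [gx gxP] := choice exg.
have rU it : supported_in (gx it).1 (U it.1).
  by have [[_ gV] _ _] := gxP it; apply: supported_inW gV; exact: VU.
have ex t : exists g, K g /\ forall i x, U i x -> g x = (gx (i, t)).1 x.
  have [||g [Gg gE gid]] := @glue_disjoint X I G U (fun i => (gx (i, t)).1) (enum I) subG dU.
  - by move=> i; have [[]] := gxP (i, t).
  - by move=> i; exact: (rU (i, t)).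
  have gE' i x : U i x -> g x = (gx (i, t)).1 x by apply: gE; rewrite mem_enum.
  exists g; split => //; split => //.
    move=> i x; have [[k _ Ux]|nD] := pselect (D x); last first.
      by rewrite gid// => k _ Uk; apply: nD; exists k.
    rewrite (gE' k)//; have Ug : U k ((gx (k, t)).1 x).
      exact/(supported_in_stable _ (rU (k, t))).
    by split => Ui; [rewrite -(dU Ug Ui)|rewrite -(dU Ux Ui)].
  by move=> x nD; apply: gid => k _ Uk; apply: nD; exists k.
have [a aP] := choice ex; exists a; split; first by move=> s; case: (aP s).
move=> s t i st; have [[Gg gV] Vx gx_] := gxP (i, t).
have Vgx : V (i, t) ((gx (i, t)).1 (gx (i, t)).2) by apply/(supported_in_stable _ gV).
exists ((gx (i, t)).1 (gx (i, t)).2); first exact: (VU (i, t)).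
have Ux : U i (gx (i, t)).2 by exact: (VU (i, t)).
have [_ at_] := aP t; have [_ as_] := aP s.
have e : (a t)^-1 ((gx (i, t)).1 (gx (i, t)).2) = (gx (i, t)).2 by rewrite -at_// bijK.
rewrite bijEM e (as_ i)//.
have [[_ gVs] _ _] := gxP (i, s); rewrite gVs; first exact/nesym.
by move=> Vs; apply: st; case: (dV _ _ _ Vs Vx).
Qed.

Let Cent i (b : bijT X) : set (bijT X) := [set g | K g /\ forall x, U i x -> g (b x) = b (g x)].

Let Cent_subgroup i b : is_subgroup (Cent i b).
Proof.
have [K1 KM KV] := subK; split => //.
- move=> g h [Kg gb] [Kh hb]; split; first exact: KM.
  by move=> x Ux; rewrite !bijEM hb// gb//; case: Kh => _ ->.
- move=> g [Kg gb]; split; first exact: KV.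
  move=> x Ux; apply: (can_inj (bijK g)); rewrite bijKV gb ?bijKV//.
  by case: (KV _ Kg) => _ ->.
Qed.

(** [b] displaces some open [W] inside [U i]. If [g] is supported in [W] and commutes with [b] on
    [U i], then [b (g y) = g (b y) = b y] for [y] in [W], so [g] is trivial. *)
Lemma centralizer_infinite_index i b x : K b -> U i x -> b x <> x ->
  ~ finite_index K (Cent i b).
Proof.
move=> Kb Ux bx; have cb : continuous b by case: Kb => /contG.
have [W [oW WU bW]] := displaced_nbhs hX cb (oU i).1 Ux bx.
apply: (rist_infinite_index oW); first exact: (rist_block_group dU WU).
  exact: Cent_subgroup.
move=> g [_ gb] [_ gW]; apply: bij_ext => y.
have [Wy|nWy] := pselect (W y); last exact: gW.
by apply: (can_inj (bijK b)); rewrite -gb ?gW//; [exact: bW|exact: WU].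
Qed.

Lemma commutators_in_confined i j (f : bijT X) x : H j f -> supported_in f (O i) -> U i x ->
  f x <> x -> finite_index K (real i j) ->
  exists W, open_nonempty W /\
    forall u v, rist G W u -> rist G W v -> H j (v * u^-1 * v^-1 * u).
Proof.
move=> Hf fO Ux fx fin.
have [W [oW WU fW]] := displaced_nbhs hX (contH Hf) (oU i).1 Ux fx.
have finW : finite_index (rist G W) (real i j).
  have [F FP] := fin; exists F => g rg; apply: FP.
  exact: (rist_block_group dU WU) rg.
have [W0 [oW0 W0W W0P]] := rist_coset_rigid oW finW.
(* One set carries [u] and [v], the second the correction [v'] of [v], the third the correction [u']
   of [u]. *)
have [V [oV VW dV]] := constant_disjoint_family 3 oW0.
pose v0 : 'I_3 := inord 0; pose v1 : 'I_3 := inord 1; pose v2 : 'I_3 := inord 2.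
have dis m k : m <> k -> forall y, V m y -> ~ V k y.
  by move=> mk y Vm Vk; apply: mk; exact: dV Vm Vk.
have n01 : v0 <> v1 by move/(congr1 val); rewrite /= !inordK.
have n02 : v0 <> v2 by move/(congr1 val); rewrite /= !inordK.
have n12 : v1 <> v2 by move/(congr1 val); rewrite /= !inordK.
have [_ LM LV] := real_subgroup i j.
have tr k v : rist G (V v0) v -> exists v', rist G (V k) v' /\ real i j (v'^-1 * v).
  move=> rv; have [v' [c [rv' Lv Lv']]] := W0P _ (oV k) (@VW k) v (rist_sub (@VW v0) rv).
  exists v'; split => //.
  by have := LM _ _ (LV _ Lv') Lv; rewrite invgM invgK !mulgA mulgK.
have supW m g : rist G (V m) g -> supported_in g W.
  by move=> [_]; apply: supported_inW => y /VW/W0W.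
exists (V v0); split => // u v ru rv.
have [v' [rv' Lv]] := tr v1 v rv; have [u' [ru' Lu]] := tr v2 u ru.
have com m k g h : m <> k -> rist G (V m) g -> rist G (V k) h -> commute g h.
  by move=> /dis; exact: rist_commute.
have c1 : commute v' v := com _ _ _ _ (nesym n01) rv' rv.
have c2 : commute v' (u'^-1 * u).
  apply: commuteM; last exact: com _ _ _ _ (nesym n01) rv' ru.
  by apply: commuteV; exact: com _ _ _ _ n12 rv' ru'.
have c3 : commute u' v := com _ _ _ _ (nesym n02) ru' rv.
rewrite -(commutator_drop_right u c3) -(commutator_drop_left c1 c2).
have WO : W `<=` O i by move=> y /WU/UO.
apply: (commutator_mem (subH j) (@KO i) Hf fO WO fW Lv Lu).
  by apply: supported_inM; [apply: supported_inV; exact: supW rv'|exact: supW rv].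
by apply: supported_inM; [apply: supported_inV; exact: supW ru'|exact: supW ru].
Qed.

Lemma exists_commutators_in_confined : exists j W, open_nonempty W /\
  forall u v, rist G W u -> rist G W v -> H j (v * u^-1 * v^-1 * u).
Proof.
pose N := #|{: I * J}|.
(* One element more than there are pairs [(i, j)], for the pigeonhole principle. *)
have [a [Ka aP]] := spread_elements N.+1.
have [K1 KM KV] := subK.
pose S (c : I * J * 'I_N.+1 * 'I_N.+1) : set (bijT X) := let: (i, j, s, t) := c in
  [set g | [/\ s <> t, K g, conf i j (g * a s) & conf i j (g * a t)]].
pose good i j := exists f x, [/\ H j f, supported_in f (O i), U i x & f x <> x].
(* For a good pair, a conjugate of [real i j]; otherwise a centralizer, to be excluded by its
   infinite index. *)
pose L (c : I * J * 'I_N.+1 * 'I_N.+1) : set (bijT X) := let: (i, j, s, t) := c in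
  if `[< good i j >] then [set g | real i j ((a s)^-1 * g * a s)]
  else Cent i (a s * (a t)^-1).
have subL c : is_subgroup (L c).
  case: c => [[[i j] s] t] /=; case: asboolP => _; last exact: Cent_subgroup.
  have [R1 RM RV] := real_subgroup i j; split => /=.
  - by rewrite mulg1 mulVg.
  - move=> g h Rg Rh; have := RM _ _ Rg Rh.
    by rewrite !mulgA mulgK.
  - by move=> g Rg; have := RV _ Rg; rewrite !invgM invgK !mulgA.
have LK c : L c `<=` K.
  case: c => [[[i j] s] t] /=; case: asboolP => _ g; last by case.
  move=> [Kg _]; have := KM _ _ (KM _ _ (Ka s) Kg) (KV _ (Ka s)).
  by rewrite !mulgA mulgV mul1g mulgK.
have SL c g h : S c g -> S c h -> L c (g^-1 * h).
  case: c => [[[i j] s] t] /= [st Kg cgs cgt] [_ Kh chs cht].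
  case: asboolP => [_|ngood] /=.
    have := conjugators_realized subK (subH j) (@KO i) KD (@pVO i) cgs chs.
    by rewrite invgM !mulgA.
  have Kgh : K (g^-1 * h) by apply: (KM) => //; exact: KV.
  have [f [Hf fO fE]] := four_conjugators subK (subH j) (@KO i) KD
    (@pVO i) (@pD i) (Ka s) (Ka t) cgs cgt chs cht.
  move: (g^-1 * h) Kgh fE => tau Ktau fE.
  (* At this [y], the equation [f y = y] says that [tau] and [a s * (a t)^-1] commute at [x]. *)
  split => // x Ux; set y := (a t)^-1 (tau x).
  have Uk k z : K k -> U i (k z) <-> U i z by move=> [_ kU _]; exact: kU.
  have Uy : U i y by rewrite /y !Uk//; exact: KV.
  have fy : f y = y by apply: contrapT => fy; apply: ngood; exists f, y.
  move: fy; rewrite fE; last exact: UO.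
  rewrite /y !bijEM bijKV bijK => e.
  by rewrite -e bijKV.
have cov g : K g -> exists c, S c g.
  move=> Kg; have ex s : exists ij : I * J, conf ij.1 ij.2 (g * a s).
    have Kga : K (g * a s) by apply: KM.
    have [i [j Hij]] : exists i j, H j ((g * a s)^-1 * p i * (g * a s)).
      by apply: confined; case: Kga.
    by exists (i, j).
  have [c cP] := choice ex.
  have [|s [t [st cst]]] := @finite_collision 'I_N.+1 (I * J)%type c.
    by rewrite card_ord.
  exists (c s, s, t); case: (c s) cst (cP s) (cP t) => i j <- /= cs ct.
  by split.
have [[[[i j] s] t] [g [st _ _ _]] fin] := neumann_cover subK subL LK SL cov.
move: fin => /=; case: asboolP => [[f [x [Hf fO Ux fx]]]|_] fin; last first.
  have [x Ux bx] := aP s t i st.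
  exfalso; apply: centralizer_infinite_index Ux bx fin.
  by apply: KM => //; exact: KV.
exists j; apply: commutators_in_confined Hf fO Ux fx _.
exact: (@finite_index_conj _ K subK (real i j) (a s) (Ka s) fin).
Qed.

End Blocks.

Lemma confined_commutators : exists j W, open_nonempty W /\
  forall u v, rist G W u -> rist G W v -> H j (v * u^-1 * v^-1 * u).
Proof.
have [U [oU dU pU gU]] := generic_blocks.
exact: (exists_commutators_in_confined oU dU pU gU).
Qed.

End Confined.

(** * Translation between homeomorphisms and bundled bijections *)

Lemma is_homeo_bijT (X : topologicalType) (f : X -> X) :
  is_homeo f -> exists g : bijT X, bij_fun g = f.
Proof. by move=> [_ [g [[fK gK] _]]]; exists (Bij fK gK). Qed.

Lemma homeo_subgroup_bijT (X : topologicalType) (H : set (X -> X)) :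
  homeo_subgroup H -> is_subgroup [set g : bijT X | H g].
Proof.
move=> [_ H1 HM HV]; split=> /=; first exact: H1.
  by move=> g h; exact: HM.
by move=> g Hg; apply: HV Hg _; split; [exact: bijK|exact: bijKV].
Qed.

Unset Implicit Arguments.
Local Close Scope group_scope.

Theorem theorem4p5 (X : topologicalType) (hX : hausdorff_space X)
  (G : set (X -> X)) (hG : homeo_subgroup G)
  (n : nat) (hn : (1 <= n)%N) (H : 'I_n -> set (X -> X))
  (hH : forall j, homeo_subgroup (H j))
  (hconf : confined_tuple G H) :
  exists (k : 'I_n) (U : set X),
    [/\ open U, U !=set0 & derived (Rist G U) `<=` H k].
Proof.
pose Gb := [set g : bijT X | G g]; pose Hb j := [set g : bijT X | H j g].
(* [derived] is the least [homeo_subgroup] containing the commutators, so it suffices to treat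
   these. *)
suff [k [U [[oU U0] kU]]] : exists k U, open_nonempty U /\
    forall u v, rist Gb U u -> rist Gb U v -> Hb k (v * u^-1 * v^-1 * u)%g.
  exists k, U; split => // f; apply; first exact: hH.
  move=> c [a [b [ai [bi [[Ga aU] [Gb' bU] [aK aiK] [bK biK] ->]]]]].
  (* With [u = b] and [v = a^-1] the commutator becomes [a^-1 b^-1 a b]. *)
  have := kU (Bij bK biK) (Bij aiK aK); apply; first by split.
  split; last exact: (@supported_inV _ (Bij aK aiK)).
  by case: hG => _ _ _ GV; apply: (GV a).
have subG : is_subgroup Gb := homeo_subgroup_bijT hG.
have subH j : is_subgroup (Hb j) := homeo_subgroup_bijT (hH j).
have [ntr|/existsNP[W /not_implyP[oW triv]]] := pselect
  (forall W, open_nonempty W -> exists2 g, rist Gb W g & g <> 1%g); last first.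
  (* A trivial rigid stabilizer has only trivial commutators, so any index will do; [hn] provides
     the index [0]. *)
  exists (Ordinal hn), W; split => // u v ru rv.
  have triv1 g : rist Gb W g -> g = 1%g.
    by move=> rg; apply: contrapT => g1; apply: triv; exists g.
  rewrite (triv1 _ ru) (triv1 _ rv) invg1 !mulg1.
  by have [] := subH (Ordinal hn).
have [P [Phomeo Pconf]] := hconf.
(* Positions in [P] index the confining maps, so the default [id] is never reached. *)
have Pnth (i : 'I_(size P)) : is_homeo (nth id P i) /\ nth id P i <> id.
  exact/Phomeo/mem_nth.
have [p pE] := choice (fun i => is_homeo_bijT (Pnth i).1).
apply: (@confined_commutators X Gb 'I_(size P) 'I_n p Hb hX subG subH) => //.
- by move=> g Gg; case: hG => /(_ _ Gg)[].
- by move=> j g Hg; case: (hH j) => /(_ _ Hg)[].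
- by move=> i; rewrite pE; case: (Pnth i) => [[]].
- by move=> i pi1; case: (Pnth i) => _; rewrite -pE pi1; apply.
move=> g Gg; have inv_g : is_inv g (g^-1)%g by split; [exact: bijK|exact: bijKV].
have [j [h [Hh Ph]]] := Pconf g Gg _ inv_g.
have iP : (index (g \o h \o (g^-1)%g) P < size P)%N by rewrite index_mem.
exists (Ordinal iP), j; rewrite /Hb /=.
(* Confinement puts [g h g^-1] in [P]; conjugating back recovers [h]. *)
suff -> : bij_inv g \o p (Ordinal iP) \o g = h by [].
by apply: funext => x; rewrite /= pE /= nth_index//= !bij_funK.
Qed.
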